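(* Let $f:\mathbb{H}^n\to\mathbb{R}$ be h-convex and $L$-Lipschitz ($L>0$), let $p\in\mathbb{H}^n$, $r>0$, and $f^*=\min_{x\in\bar B(p,r)}f(x)$. Let $\delta\in(0,r)$. Let $x_0=p$ and, for $k\ge0$, $$x_{k+1}=\exp_{x_k}\Big(-\delta\frac{g_k}{\|g_k\|}\Big),\qquad g_k\in\partial^{\mathsf h}f(x_k)$$ (with $x_{k+1}=x_k$ if $g_k=0$). Then $$\min_{k=0,1,\dots,N}\{f(x_k)-f^*\}\le L\delta$$ provided $N\ge\frac{\log\cosh(r)}{\log\cosh(\delta)}$. In particular, when $\delta\le1$, it is enough that $N\ge\frac4r\cdot\frac{r^2}{\delta^2}$.
   Context: $\mathbb{H}^n$ is $n$-dimensional hyperbolic space (complete, simply connected, constant sectional curvature $-1$), with distance $d$ and exponential map $\exp_p$; $\bar B(p,r)$ is the closed geodesic ball. For $y\in\mathbb{H}^n$ and a unit tangent vector $u$ at $y$, $B_{y,u}(x)=\lim_{t\to\infty}\big(d(\exp_y(-tu),x)-t\big)$; for $s\ge 0$, $B_{y,su}:=sB_{y,u}$ (so $B_{y,0}=0$). $\partial^{\mathsf h}f(y)$ is the set of tangent vectors $v$ at $y$ with $f(x)-f(y)\ge B_{y,v}(x)$ for all $x\in\mathbb{H}^n$; $f$ is h-convex if $\partial^{\mathsf h}f(y)\neq\emptyset$ for all $y$. *)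

(* Defs.v *)
From HB Require Import structures.
From mathcomp Require Import all_boot all_order all_algebra.
From mathcomp Require Import all_classical all_reals all_analysis.
From mathcomp Require Import ring lra.
Import Order.TTheory GRing.Theory Num.Theory.
Import numFieldNormedType.Exports.

Set Implicit Arguments.
Unset Strict Implicit.
Unset Printing Implicit Defensive.

Local Open Scope classical_set_scope.
Local Open Scope ring_scope.

(* Hyperbolic space is realised as the upper sheet of the hyperboloid
   <x, x> = -1 in Minkowski space R^(n+1); coordinate 0 is the time-like one.
   The induced metric has constant curvature -1, the tangent space at y is the
   orthogonal of y, cosh d(x, y) = - <x, y>, and the geodesic issued from y with
   velocity v is t |-> cosh (t |v|) y + (sinh (t |v|) / |v|) v. *)

Section HyperbolicFunctions.
Variable R : realType.
Implicit Types x : R.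

Definition cosh x : R := (expR x + expR (- x)) / 2.
Definition sinh x : R := (expR x - expR (- x)) / 2.

(* Inverse of cosh : [0, +oo[ -> [1, +oo[; only meaningful for 1 <= x. *)
Definition arcosh x : R := ln (x + Num.sqrt (x ^+ 2 - 1)).

Lemma sinh0 : sinh 0 = 0.
Proof. by rewrite /sinh oppr0 subrr mul0r. Qed.

Lemma cosh2_sinh2 x : cosh x ^+ 2 - sinh x ^+ 2 = 1.
Proof.
have : expR x * expR (- x) = 1 by rewrite -expRD subrr expR0.
rewrite /cosh /sinh => e1.
transitivity (expR x * expR (- x)); last exact: e1.
by field.
Qed.

Lemma cosh_gt0 x : 0 < cosh x.
Proof. by rewrite divr_gt0// addr_gt0// expR_gt0. Qed.

Lemma sinh_ge0 x : 0 <= x -> 0 <= sinh x.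
Proof.
by move=> x0; rewrite divr_ge0// subr_ge0 ler_expR; lra.
Qed.

Lemma sinh_lt_cosh x : sinh x < cosh x.
Proof. by have := expR_gt0 (- x); rewrite /cosh /sinh; lra. Qed.

End HyperbolicFunctions.

Section Hyperboloid.
Variables (R : realType) (n : nat).
Implicit Types a b c : 'rV[R]_n.+1.

Definition lorentz a b : R :=
  \sum_(i < n) a 0 (lift ord0 i) * b 0 (lift ord0 i) - a 0 0 * b 0 0.

Lemma lorentzC a b : lorentz a b = lorentz b a.
Proof.
by rewrite /lorentz mulrC; congr (_ - _); apply: eq_bigr => i _; rewrite mulrC.
Qed.

Lemma lorentzP k a b c :
  lorentz c (k *: a + b) = k * lorentz c a + lorentz c b.
Proof.
rewrite /lorentz !mxE mulrBr mulr_sumr.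
under eq_bigr do rewrite !mxE mulrDr mulrCA.
by rewrite big_split /=; ring.
Qed.

Lemma lorentz0 c : lorentz c 0 = 0.
Proof.
by rewrite /lorentz !mxE mulr0 subr0 big1// => i _; rewrite mxE mulr0.
Qed.

Record hyp := Hyp {
  hval :> 'rV[R]_n.+1 ;
  hypP : (lorentz hval hval == -1) && (0 < hval 0 0) }.
HB.instance Definition _ := [isSub for hval].

Definition tangent_pred (y : hyp) : {pred 'rV[R]_n.+1} :=
  [pred v | lorentz y v == 0].

Lemma tangent_submod y : submod_closed (tangent_pred y).
Proof.
split=> [|k u v]; rewrite !inE ?lorentz0// => /eqP u0 /eqP v0.
by rewrite lorentzP u0 v0 mulr0 addr0.
Qed.
HB.instance Definition _ y :=
  GRing.isSubmodClosed.Build R 'rV[R]_n.+1 (tangent_pred y) (tangent_submod y).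

Record tangent (y : hyp) := Tangent {
  tval :> 'rV[R]_n.+1 ;
  tangentP : tval \in tangent_pred y }.
HB.instance Definition _ y := [isSub for @tval y].
HB.instance Definition _ y := [Choice of tangent y by <:].
HB.instance Definition _ y := [SubChoice_isSubLmodule of tangent y by <:].

Definition tnorm y (v : tangent y) : R := Num.sqrt (lorentz v v).

Definition dist (x y : hyp) : R := arcosh (- lorentz x y).

(* The quotient is 0 / 0 = 0 at v = 0, so that the value there is y. *)
Definition exp_val y (v : tangent y) : 'rV[R]_n.+1 :=
  cosh (tnorm v) *: hval y + (sinh (tnorm v) / tnorm v) *: tval v.

Lemma tangent_bound y (v : tangent y) :
  (v : 'rV_n.+1) 0 0 ^+ 2 <= (y : 'rV_n.+1) 0 0 ^+ 2 * lorentz v v.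
Proof.
have /andP[/eqP yy _] := hypP y.
have yv : lorentz y v = 0 by apply/eqP; exact: tangentP v.
move: yy yv; move: (hval y) (tval v) => {v}{}y v yy yv.
have : 0 <= \sum_(i < n) (y 0 0 * v 0 (lift ord0 i)
                          - v 0 0 * y 0 (lift ord0 i)) ^+ 2.
  by apply: sumr_ge0 => i _; exact: sqr_ge0.
have -> : \sum_(i < n) (y 0 0 * v 0 (lift ord0 i)
                        - v 0 0 * y 0 (lift ord0 i)) ^+ 2
  = y 0 0 ^+ 2 * (lorentz v v + v 0 0 ^+ 2)
    - 2 * y 0 0 * v 0 0 * (lorentz y v + y 0 0 * v 0 0)
    + v 0 0 ^+ 2 * (lorentz y y + y 0 0 ^+ 2).
  rewrite /lorentz !expr2 !subrK !mulr_sumr -sumrB -big_split /=.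
  by apply: eq_bigr => i _; ring.
by rewrite yy yv; nra.
Qed.

Lemma lorentz_tangent_ge0 y (v : tangent y) : 0 <= lorentz v v.
Proof.
have /andP[_ y0] := hypP y.
have := le_trans (sqr_ge0 _) (tangent_bound v).
by rewrite pmulr_rge0// exprn_gt0.
Qed.

Lemma exp_valP y (v : tangent y) :
  (lorentz (exp_val v) (exp_val v) == -1) && (0 < exp_val v 0 0).
Proof.
have /andP[/eqP yy y0] := hypP y.
have yv : lorentz y v = 0 by apply/eqP; exact: tangentP v.
have q0 := lorentz_tangent_ge0 v.
set t := tnorm v; have t0 : 0 <= t by exact: sqrtr_ge0.
have tE : t ^+ 2 = lorentz v v by exact: sqr_sqrtr.
have sE : sinh t / t * t = sinh t.
  by have [->|tn0] := eqVneq t 0; rewrite ?sinh0 ?mul0r// divfK.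
have k0 : 0 <= sinh t / t by rewrite divr_ge0// sinh_ge0.
rewrite /exp_val -/t; move: sE k0; set k := sinh t / t => sE k0.
apply/andP; split.
- rewrite lorentzP -[k *: tval v]addr0 lorentzP lorentz0 addr0.
  rewrite ![lorentz (_ + _) _]lorentzC !lorentzP.
  rewrite -[k *: tval v]addr0 !lorentzP !lorentz0 (lorentzC v y) yy yv -tE.
  by rewrite -[X in _ == - X](cosh2_sinh2 t) -sE; apply/eqP; ring.
- rewrite !mxE.
  have : `|(v : 'rV_n.+1) 0 0| <= (y : 'rV_n.+1) 0 0 * t.
    rewrite -ler_sqr ?nnegrE ?mulr_ge0 ?(ltW y0)//.
    by rewrite real_normK ?num_real// exprMn tE tangent_bound.
  rewrite ler_norml => /andP[vl _].
  have := ler_wpM2l k0 vl.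
  have -> : k * - ((y : 'rV_n.+1) 0 0 * t) = - ((y : 'rV_n.+1) 0 0 * sinh t).
    by rewrite -sE; ring.
  have := sinh_lt_cosh t; nra.
Qed.

Definition hexp y (v : tangent y) : hyp := Hyp (exp_valP v).

Definition cball (p : hyp) (r : R) : set hyp := [set x | dist p x <= r].

Definition busemann_unit y (u : tangent y) (x : hyp) : R :=
  lim ((fun t : R => dist (hexp (- (t *: u))) x - t) @ +oo).

(* Every nonzero v is s u with s = |v| > 0 and u = v / |v| a unit vector. *)
Definition busemann y (v : tangent y) (x : hyp) : R :=
  if v == 0 then 0 else tnorm v * busemann_unit ((tnorm v)^-1 *: v) x.

Definition hsubdiff (f : hyp -> R) (y : hyp) : set (tangent y) :=
  [set v | forall x, busemann v x <= f x - f y].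

Definition hconvex (f : hyp -> R) := forall y, @hsubdiff f y !=set0.

Definition hlipschitz (L : R) (f : hyp -> R) :=
  forall x y, `|f x - f y| <= L * dist x y.

Definition subgrad_step (delta : R) y (g : tangent y) : hyp :=
  if g == 0 then y else hexp (- ((delta / tnorm g) *: g)).

End Hyperboloid.

Arguments hsubdiff {R n} f y _.

(* Main.v *)
Require Import Defs.
From mathcomp Require Import all_boot all_order all_algebra.
From mathcomp Require Import all_classical all_reals all_analysis.
From mathcomp Require Import ring lra.
Set Implicit Arguments.
Unset Strict Implicit.
Import Order.TTheory GRing.Theory Num.Theory.
Import numFieldNormedType.Exports.
Local Open Scope classical_set_scope.
Local Open Scope ring_scope.

(** The method contracts cosh of the distance to a minimiser z by the factor
    1 / cosh delta at every step at which the gap f (x k) - f z still exceeds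
    L * delta; since cosh of a distance is at least 1, this can happen at most
    log_(cosh delta) (cosh r) times in a row, which is fewer than N + 1.

    To see the contraction, let y be the current point, g <> 0 a subgradient,
    u = g / |g|. On the hyperboloid the Busemann function has the closed form
    B_(y,u)(z) = ln (<z, u> - <z, y>) (busemann_unitE). It equals t at
    exp_y(t u), so the subgradient inequality there and the Lipschitz bound
    give |g| <= L (hsubdiff_norm_le). The subgradient inequality at z reads
    |g| B_(y,u)(z) <= f z - f y < - L * delta, hence B_(y,u)(z) < - delta. So z
    lies in the horoball B_(y,u) <= - delta, and the next point
    w = exp_y(- delta u) is the point where the geodesic followed by the step
    meets its boundary, at a right angle. The horoball being convex, the
    geodesic from w to z makes an angle of at least a right angle with the one
    from w back to y, and the law of cosines yields
    cosh (d (y, z)) >= cosh delta * cosh (d (w, z)) (horoball_contraction).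

    The second sufficient condition on N implies the first, by ln (cosh r) <= r
    and delta ^ 2 / 4 <= ln (cosh delta) for delta <= 1. *)

(** * Hyperbolic functions *)

Lemma coshDsinh (R : realType) (t : R) : cosh t + sinh t = expR t.
Proof. by rewrite /cosh /sinh; field. Qed.

Lemma coshBsinh (R : realType) (t : R) : cosh t - sinh t = expR (- t).
Proof. by rewrite /cosh /sinh; field. Qed.

Lemma coshN (R : realType) (t : R) : cosh (- t) = cosh t.
Proof. by rewrite /cosh opprK addrC. Qed.

Lemma sinhN (R : realType) (t : R) : sinh (- t) = - sinh t.
Proof. by rewrite /sinh opprK; field. Qed.

Lemma cosh_norm (R : realType) (t : R) : cosh `|t| = cosh t.
Proof. by have [_|_] := ger0P t; rewrite ?coshN. Qed.

Lemma cosh_ge1 (R : realType) (t : R) : 1 <= cosh t.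
Proof.
have := cosh2_sinh2 t; have := sqr_ge0 (sinh t); have := cosh_gt0 t; nra.
Qed.

Lemma arcosh_cosh (R : realType) (t : R) : 0 <= t -> arcosh (cosh t) = t.
Proof.
move=> t0; rewrite /arcosh.
have -> : cosh t ^+ 2 - 1 = sinh t ^+ 2 by rewrite -(cosh2_sinh2 t); ring.
by rewrite sqrtr_sqr ger0_norm ?sinh_ge0// coshDsinh expRK.
Qed.

(** Monotonicity stops at 1: as [ln] and the square root vanish on negative
    numbers and at 0, arcosh 0 = 0 exceeds arcosh (1 / 2) = ln (1 / 2). *)
Lemma ler_arcosh (R : realType) : {in [pred a : R | 1 <= a] &,
  {mono @arcosh R : a b / a <= b}}.
Proof.
apply: le_mono_in => a b; rewrite !inE => a1 b1 ab.
have s0 := sqrtr_ge0 (a ^+ 2 - 1).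
have ss : Num.sqrt (a ^+ 2 - 1) <= Num.sqrt (b ^+ 2 - 1).
  by rewrite ler_sqrt; nra.
by rewrite /arcosh ltr_ln ?posrE; lra.
Qed.

Lemma arcosh_le (R : realType) (a t : R) :
  1 <= a -> 0 <= t -> (arcosh a <= t) = (a <= cosh t).
Proof.
by move=> a1 t0; rewrite -{1}(arcosh_cosh t0) ler_arcosh ?inE ?cosh_ge1.
Qed.

Lemma cosh_gt1 (R : realType) (t : R) : 0 < t -> 1 < cosh t.
Proof.
have cosh0 : cosh 0 = 1 :> R by rewrite /cosh oppr0 expR0; field.
move=> t0; rewrite ltNge -[leRHS]cosh0 -arcosh_le ?cosh_ge1//.
by rewrite (arcosh_cosh (ltW t0)) -ltNge.
Qed.

Lemma cosh_le_expR (R : realType) (t : R) : 0 <= t -> cosh t <= expR t.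
Proof. by move=> t0; rewrite -coshDsinh lerDl sinh_ge0. Qed.

(** From cosh t - 1 = (e^(t/2) - e^(-t/2))^2 / 2 and 1 + h <= e^h, which give
    e^(t/2) - e^(-t/2) >= 5 t / 6, whence 25/72 = (5/6)^2 / 2. The sharp
    coefficient is 1/2, but 25/72 leads to the constant 1/4 of [ln_cosh_ge]. *)
Lemma cosh_ge_quadratic (R : realType) (t : R) : 0 <= t <= 1 ->
  1 + 25 / 72 * t ^+ 2 <= cosh t.
Proof.
move=> /andP[t0 t1].
have e1 := expR_ge1Dx (t / 2); have e2 := expRN (t / 2).
have e0 := expR_gt0 (t / 2).
have tE : t = t / 2 + t / 2 by field.
rewrite /cosh [in expR t]tE [in expR (- t)]tE opprD !expRD.
move: e1 e0 e2; set a := expR (t / 2); set b := expR (- (t / 2)) => e1 e0 e2.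
have ab : a * b = 1 by rewrite e2 divff// gt_eqF.
have b0 : 0 < b by exact: expR_gt0.
have b1 : (1 + t / 2) * b <= 1 by rewrite -[leRHS]ab ler_pM2r.
(* 1 / (1 + t / 2) is convex in t, hence below its chord 1 - t / 3 on [0, 1] *)
have b2 : b <= 1 - t / 3.
  by rewrite leNgt; apply/negP => b2; nra.
have ab_ge : 5 / 6 * t <= a - b by lra.
have sq : (5 / 6 * t) ^+ 2 <= (a - b) ^+ 2 by rewrite ler_sqr ?nnegrE; lra.
have -> : (a * a + b * b) / 2 = a * b + (a - b) ^+ 2 / 2 by field.
rewrite ab; lra.
Qed.

Lemma ln_cosh_ge (R : realType) (t : R) : 0 <= t <= 1 ->
  t ^+ 2 / 4 <= ln (cosh t).
Proof.
move=> t01; have := cosh_ge_quadratic t01.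
move: (cosh_gt0 t); set c := cosh t => c0 ct.
have /andP[t0 t1] := t01.
(* ln c >= 1 - 1 / c, in the form ln (1 / c) <= 1 / c - 1 *)
have : ln c^-1 <= c^-1 - 1.
  have := @le_ln1Dx R (c^-1 - 1); rewrite subrKC; apply.
  have : 0 < c^-1 by rewrite invr_gt0.
  lra.
rewrite lnV ?posrE// => lc.
suff : c^-1 <= 1 - t ^+ 2 / 4 by lra.
rewrite invf_ple ?posrE//; last nra.
apply: le_trans ct.
have q1 : t ^+ 2 <= 1 by rewrite expr_le1.
have u0 : 0 < 1 - t ^+ 2 / 4 by lra.
rewrite -(ler_pM2r u0) mulVf ?gt_eqF//.
by move: (sqr_ge0 t) q1; set q := t ^+ 2 => q0 q1; nra.
Qed.

Lemma ln_cosh_ratio_le (R : realType) (r delta : R) :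
  0 < r -> 0 < delta <= 1 ->
  ln (cosh r) / ln (cosh delta) <= 4 / r * (r ^+ 2 / delta ^+ 2).
Proof.
move=> r0 /andP[d0 d1].
have d2 : 0 < delta ^+ 2 by rewrite exprn_gt0.
have lnd : delta ^+ 2 / 4 <= ln (cosh delta).
  by rewrite ln_cosh_ge// d1 (ltW d0).
have lnr : ln (cosh r) <= r.
  rewrite -[leRHS]expRK ler_ln ?posrE ?cosh_gt0 ?expR_gt0//.
  by rewrite cosh_le_expR// ltW.
have -> : 4 / r * (r ^+ 2 / delta ^+ 2) = r / (delta ^+ 2 / 4).
  by field; rewrite !gt_eqF.
by rewrite ler_pM ?invr_ge0 ?ln_ge0 ?cosh_ge1 ?lef_pV2 ?posrE//; lra.
Qed.

(** * Geodesics and Busemann functions of the hyperboloid *)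

Lemma lorentzZr (R : realType) (n : nat) (k : R) (a c : 'rV[R]_n.+1) :
  lorentz c (k *: a) = k * lorentz c a.
Proof. by rewrite -[k *: a]addr0 lorentzP lorentz0 addr0. Qed.

Lemma lorentz_hyp (R : realType) (n : nat) (x : hyp R n) : lorentz x x = -1.
Proof. by have /andP[/eqP] := hypP x. Qed.

(** The reversed Cauchy-Schwarz inequality. Expanding
    0 <= \sum_i (x_0 y_i - y_0 x_i)^2 gives
    2 x_0 y_0 (- <x, y>) >= x_0^2 + y_0^2 >= 2 x_0 y_0. *)
Lemma lorentz_hyp_ge1 (R : realType) (n : nat) (x y : hyp R n) :
  1 <= - lorentz x y.
Proof.
have /andP[_ x0] := hypP x; have /andP[_ y0] := hypP y.
have := lorentz_hyp x; have := lorentz_hyp y.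
move: (hval x) (hval y) x0 y0 => {}x {}y x0 y0 yy xx.
have : 0 <= \sum_(i < n) (x 0 0 * y 0 (lift ord0 i)
                          - y 0 0 * x 0 (lift ord0 i)) ^+ 2.
  by apply: sumr_ge0 => i _; exact: sqr_ge0.
have -> : \sum_(i < n) (x 0 0 * y 0 (lift ord0 i)
                        - y 0 0 * x 0 (lift ord0 i)) ^+ 2
  = x 0 0 ^+ 2 * (lorentz y y + y 0 0 ^+ 2)
    - 2 * x 0 0 * y 0 0 * (lorentz x y + x 0 0 * y 0 0)
    + y 0 0 ^+ 2 * (lorentz x x + x 0 0 ^+ 2).
  rewrite /lorentz !expr2 !subrK !mulr_sumr -sumrB -big_split /=.
  by apply: eq_bigr => i _; ring.
rewrite xx yy => h.
have xy0 : 0 < x 0 0 * y 0 0 by rewrite mulr_gt0.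
have h2 := sqr_ge0 (x 0 0 - y 0 0).
have : 0 <= x 0 0 * y 0 0 * (- lorentz x y - 1) by lra.
by rewrite pmulr_rge0// subr_ge0.
Qed.

Section Tangent.
Variables (R : realType) (n : nat) (y : hyp R n).
Implicit Types (u v : tangent y) (x : hyp R n) (t : R).

(** The Lorentz form is positive definite on tangent spaces: if <v, v> = 0, then
    [tangent_bound] kills the time-like coordinate of v, and what is left of
    <v, v> is a Euclidean norm. *)
Lemma tnorm_gt0 v : v != 0 -> 0 < tnorm v.
Proof.
move=> v0; rewrite sqrtr_gt0 lt_def lorentz_tangent_ge0 andbT.
apply: contra v0 => /eqP vv; apply/eqP/val_inj => /=.
have := tangent_bound v; rewrite vv mulr0 real_exprn_even_le0 ?num_real//=.
move=> /eqP v00; move: vv; rewrite /lorentz v00 mulr0 subr0.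
move/eqP; rewrite psumr_eq0 => [/allP vi|i _]; last by rewrite -expr2 sqr_ge0.
apply/rowP => j; rewrite mxE; case: (unliftP ord0 j) => [i ->|->//].
by have := vi i (mem_index_enum _); rewrite mulf_eq0 orbb => /eqP.
Qed.

Lemma tnormZ t v : tnorm (t *: v) = `|t| * tnorm v.
Proof.
rewrite /tnorm /= lorentzZr lorentzC lorentzZr mulrA -expr2.
by rewrite sqrtrM ?sqr_ge0// sqrtr_sqr.
Qed.

(** Valid for t of either sign, although [hexp] is defined through the norm
    |t|, because t |-> sinh t / t is even. The first argument ranges over the
    ambient space so that it can be a tangent vector as well. *)
Lemma lorentz_geodesic u t (x : 'rV[R]_n.+1) : tnorm u = 1 ->
  lorentz x (hexp (t *: u)) = cosh t * lorentz x y + sinh t * lorentz x u.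
Proof.
move=> u1; rewrite /= /exp_val tnormZ u1 mulr1 lorentzP !lorentzZr cosh_norm.
congr (_ + _); rewrite mulrA; congr (_ * _).
have [t0|t0] := ger0P t; last by rewrite sinhN invrN mulrNN divfK// lt_eqF.
by have [->|tn0] := eqVneq t 0; rewrite ?mulr0 ?sinh0// divfK.
Qed.

(** If <x, u> - <x, y> were not positive, then - <x, exp_y(- t u)>, in which
    this number is the coefficient of e^t / 2, would drop below 1 for t large,
    against [lorentz_hyp_ge1]. *)
Lemma horofunction_gt0 u x : tnorm u = 1 -> 0 < lorentz x u - lorentz x y.
Proof.
move=> u1; rewrite ltNge; apply/negP => h.
set c := - lorentz x u - lorentz x y.
(* z plays e^t; it has to dominate c, the coefficient of e^(- t) / 2 *)
set z := `|c| + 1.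
have z0 : 1 <= z by rewrite lerDr.
have zE : expR (ln z) = z by rewrite lnK// posrE; lra.
have := lorentz_hyp_ge1 x (hexp (- ln z *: u)).
rewrite lorentz_geodesic// coshN sinhN /cosh /sinh expRN zE => ge1.
have zV : z^-1 <= 1 by rewrite invf_le1//; lra.
have zV0 : 0 < z^-1 by rewrite invr_gt0; lra.
have zz : z * z^-1 = 1 by rewrite divff//; lra.
have cz : c < z by rewrite /z; have := ler_norm c; lra.
move: zz zV0 zV ge1; set w := z^-1 => zz w0 w1.
have -> : - ((z + w) / 2 * lorentz x y + - ((z - w) / 2) * lorentz x u)
  = z * (lorentz x u - lorentz x y) / 2 + w * c / 2 by rewrite /c; field.
nra.
Qed.

(** With z = e^(- t), the function d (exp_y(- t u), x) - t is ln (F z) for a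
    function F continuous at 0, so the limit at infinity is ln (F 0). *)
Lemma busemann_unitE u x : tnorm u = 1 ->
  busemann_unit u x = ln (lorentz x u - lorentz x y).
Proof.
move=> u1; have w0 := horofunction_gt0 x u1.
set w := lorentz x u - lorentz x y in w0 *.
set w' := - lorentz x u - lorentz x y.
pose m (z : R) := w / 2 + z ^+ 2 * (w' / 2).
pose F (z : R) := m z + Num.sqrt (m z ^+ 2 - z ^+ 2).
have m0 : m 0 = w / 2 by rewrite /m expr0n mul0r addr0.
have F0 : F 0 = w.
  by rewrite /F m0 expr0n subr0 sqrtr_sqr gtr0_norm; lra.
apply: cvg_lim => //.
have -> : (fun t => dist (hexp (- (t *: u))) x - t)
  = (@ln R \o F) \o (fun t => expR (- t)).
  apply/funext => t /=; rewrite -scaleNr /dist lorentzC lorentz_geodesic//.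
  set d := cosh _ * _ + _.
  have d1 : 1 <= - d.
    by rewrite /d -lorentz_geodesic// lorentz_hyp_ge1.
  have e0 := expR_gt0 (- t).
  (* m (e^(- t)) is cosh of the distance, rescaled by e^(- t) *)
  have mE : m (expR (- t)) = expR (- t) * - d.
    have : expR t * expR (- t) = 1 by rewrite -expRD subrr expR0.
    rewrite /m /w /w' /d coshN sinhN /cosh /sinh.
    move: (expR t) (expR (- t)) => a b ab.
    transitivity ((a * b) * (lorentz x u - lorentz x y) / 2 +
      b ^+ 2 * ((- lorentz x u - lorentz x y) / 2)); last by field.
    by rewrite ab; field.
  have -> : F (expR (- t)) = expR (- t) * (- d + Num.sqrt ((- d) ^+ 2 - 1)).
    rewrite /F mE mulrDr; congr (_ + _).
    rewrite -[X in X * Num.sqrt _]gtr0_norm// -sqrtr_sqr -sqrtrM ?sqr_ge0//.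
    by congr Num.sqrt; ring.
  rewrite lnM ?posrE//; last by have := sqrtr_ge0 ((- d) ^+ 2 - 1); lra.
  by rewrite expRK /arcosh addrC.
rewrite -F0.
apply: (@continuous_cvg _ _ _ _ _ _ (@ln R \o F) 0); last exact: cvgr_expR.
have mc : {for 0, continuous m}.
  apply: cvgD; first exact: cvg_cst.
  by apply: cvgM; [exact: exprn_continuous|exact: cvg_cst].
apply: continuous_comp; last by apply: continuous_ln; rewrite F0.
apply: cvgD => //.
apply: continuous_comp; last exact: sqrt_continuous.
apply: cvgB; last exact: exprn_continuous.
exact: (cvgM mc mc).
Qed.

End Tangent.

(** * Contraction towards a minimiser *)

Section Contraction.
Variables (R : realType) (n : nat).
Implicit Types (x y z : hyp R n).

(** This is the law of cosines for the triangle with vertices y, z and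
    w = exp_y(- t u), whose angle at w is not acute. Algebraically, with
    a = - <z, y> and q = - <z, w>, the closed form of the Busemann function
    turns the hypothesis into q <= e^(- t) (a + sinh t). Since 1 <= q, it follows
    that cosh t <= a, and then e^(- t) (a + sinh t) <= a / cosh t. *)
Lemma horoball_contraction y (u : tangent y) z (t : R) :
  tnorm u = 1 -> 0 < t -> busemann_unit u z <= - t ->
  cosh t * - lorentz z (hexp (- t *: u)) <= - lorentz z y.
Proof.
move=> u1 t0; rewrite busemann_unitE// => bt.
have w0 := horofunction_gt0 z u1.
have {bt w0} bt : lorentz z u - lorentz z y <= expR (- t).
  by rewrite -ler_expR lnK in bt.
have := lorentz_hyp_ge1 z (hexp (- t *: u)).
rewrite lorentz_geodesic// coshN sinhN.
(* from here on, the letter a stands for <z, y>, without the minus sign *)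
move: (lorentz z y) (lorentz z u) bt => a b bt ge1.
have e0 := expR_gt0 (- t).
have s0 : 0 <= sinh t by rewrite sinh_ge0 ?ltW.
have c1 := cosh_ge1 t.
have cs := cosh2_sinh2 t.
have := ler_wpM2l s0 bt.
move: bt e0; rewrite -coshBsinh.
move: s0 c1 cs ge1; set c := cosh t; set s := sinh t => s0 c1 cs ge1 bt e0 sb.
set q := - (c * a + - s * b).
have qle : q <= (c - s) * (- a + s) by rewrite /q; lra.
(* multiply 1 <= q by c + s = e^t, the inverse of c - s = e^(- t) *)
have ca : c <= - a.
  have : (c + s) * 1 <= (c + s) * ((c - s) * (- a + s)).
    by rewrite ler_wpM2l; [|lra|rewrite /q in qle; lra].
  have -> : (c + s) * ((c - s) * (- a + s)) = (c ^+ 2 - s ^+ 2) * (- a + s).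
    by ring.
  by rewrite cs; lra.
have : c * q <= c * ((c - s) * (- a + s)) by rewrite ler_wpM2l//; lra.
move=> /le_trans; apply.
have -> : c * ((c - s) * (- a + s)) = - a + (c - s) * s * (c + a)
           + (- a) * (c ^+ 2 - s ^+ 2 - 1) by ring.
rewrite cs subrr mulr0 addr0 gerDl mulr_ge0_le0//; last lra.
by rewrite mulr_ge0// ltW.
Qed.

Lemma tnorm_normalize y (v : tangent y) : v != 0 ->
  tnorm ((tnorm v)^-1 *: v) = 1.
Proof.
move=> /tnorm_gt0 v0; rewrite tnormZ gtr0_norm ?invr_gt0//.
by rewrite mulVf// gt_eqF.
Qed.

Lemma busemann_ray y (u : tangent y) (t : R) : tnorm u = 1 ->
  busemann_unit u (hexp (t *: u)) = t.
Proof.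
move=> u1; rewrite busemann_unitE// !(lorentzC (hexp _)) !lorentz_geodesic//.
have uu : lorentz u u = 1.
  by rewrite -(sqr_sqrtr (lorentz_tangent_ge0 u)) -/(tnorm u) u1 expr1n.
have yu : lorentz y u = 0 by apply/eqP; exact: tangentP u.
rewrite uu (lorentzC u) yu lorentz_hyp.
by rewrite -[RHS]expRK -coshDsinh; congr ln; ring.
Qed.

Lemma dist_geodesic y (u : tangent y) (t : R) : tnorm u = 1 ->
  dist y (hexp (t *: u)) = `|t|.
Proof.
move=> u1; rewrite /dist lorentz_geodesic// lorentz_hyp.
have -> : lorentz y u = 0 by apply/eqP; exact: tangentP u.
by rewrite mulr0 addr0 mulrN1 opprK -cosh_norm arcosh_cosh.
Qed.

(** Test the subgradient inequality at exp_y(v / |v|), where the Busemann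
    function and the distance to y both equal 1. *)
Lemma hsubdiff_norm_le (f : hyp R n -> R) (L : R) y (v : tangent y) :
  hlipschitz L f -> v != 0 -> hsubdiff f y v -> tnorm v <= L.
Proof.
move=> lip v0 /(_ (hexp (1 *: ((tnorm v)^-1 *: v)))).
have u1 := tnorm_normalize v0.
rewrite /busemann (negPf v0) busemann_ray// mulr1 => /le_trans; apply.
rewrite (le_trans (ler_norm _))// distrC (le_trans (lip _ _))//.
by rewrite dist_geodesic// normr1 mulr1.
Qed.

(** A gap above L * t excludes v = 0, and |v| <= L turns it into a value below
    - t for the Busemann function of the unit vector v / |v| at z. *)
Lemma subgrad_step_contraction (f : hyp R n -> R) (L t : R) y (v : tangent y) z :
  hlipschitz L f -> 0 < t -> 0 < L -> hsubdiff f y v -> L * t < f y - f z ->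
  cosh t * - lorentz z (subgrad_step t v) <= - lorentz z y.
Proof.
move=> lip t0 L0 sub gap; have Lt0 : 0 < L * t by rewrite mulr_gt0.
have v0 : v != 0.
  apply/eqP => v0; have := sub z.
  by rewrite /busemann v0 eqxx; lra.
rewrite /subgrad_step (negPf v0) -scaleNr -mulNr -scalerA.
apply: horoball_contraction => //; first exact: tnorm_normalize.
have vL := hsubdiff_norm_le lip v0 sub.
have vp := tnorm_gt0 v0.
have := sub z; rewrite /busemann (negPf v0).
move: (busemann_unit _ _) => b bz.
rewrite -(ler_pM2l vp); nra.
Qed.

End Contraction.

(** Otherwise all N + 1 steps from x 0 to x (N + 1) contract, and
    (cosh delta)^(N + 1) <= cosh r, which the bound on N forbids. *)
Lemma subgradient_method_gap (R : realType) (n : nat) (f : hyp R n -> R)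
    (L r delta : R) (x : nat -> hyp R n) (g : forall k, tangent (x k))
    (z : hyp R n) (N : nat) :
  hlipschitz L f -> 0 < L -> 0 < r -> 0 < delta ->
  (forall k, hsubdiff f (x k) (g k)) ->
  (forall k, x k.+1 = subgrad_step delta (g k)) ->
  dist (x 0%N) z <= r -> ln (cosh r) / ln (cosh delta) <= N%:R ->
  exists2 k, (k < N.+1)%N & f (x k) - f z <= L * delta.
Proof.
move=> lip L0 r0 d0 sub xS z_r NE.
apply: contrapT => nogap.
have gap k : (k < N.+1)%N -> L * delta < f (x k) - f z.
  by move=> kN; rewrite ltNge; apply/negP => ?; apply: nogap; exists k.
have telescope m : (m <= N.+1)%N ->
    cosh delta ^+ m * - lorentz z (x m) <= - lorentz z (x 0%N).
  elim: m => [|m IH] mN; first by rewrite mul1r.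
  apply: le_trans (IH (ltnW mN)).
  rewrite exprSr -mulrA ler_wpM2l ?exprn_ge0 ?(ltW (cosh_gt0 _))//.
  by rewrite xS; exact: subgrad_step_contraction (gap _ mN).
have lnd : 0 < ln (cosh delta) by rewrite ln_gt0 ?cosh_gt1.
have : cosh delta ^+ N.+1 <= cosh r.
  rewrite -[leLHS]mulr1.
  apply: le_trans (ler_wpM2l _ (lorentz_hyp_ge1 z (x N.+1))) _.
    by rewrite exprn_ge0// ltW// cosh_gt0.
  apply: le_trans (telescope _ (leqnn _)) _.
  by rewrite lorentzC -arcosh_le ?lorentz_hyp_ge1// ltW.
rewrite -ler_ln ?posrE ?exprn_gt0 ?cosh_gt0// lnXn ?cosh_gt0//.
rewrite -mulr_natl -ler_pdivlMr// => /le_trans/(_ NE).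
by rewrite ler_nat ltnn.
Qed.

Unset Implicit Arguments.
Set Strict Implicit.

Theorem proposition7 (R : realType) (n : nat) (f : hyp R n -> R) (L : R)
    (p : hyp R n) (r fstar delta : R)
    (x : nat -> hyp R n) (g : forall k : nat, tangent (x k))
    (f_hconvex : hconvex f) (L_gt0 : 0 < L) (f_lip : hlipschitz L f)
    (r_gt0 : 0 < r)
    (fstar_min : (f @` cball p r) fstar /\ lbound (f @` cball p r) fstar)
    (delta_gt0 : 0 < delta) (delta_lt_r : delta < r)
    (x0E : x 0%N = p)
    (g_subdiff : forall k : nat, hsubdiff f (x k) (g k))
    (xSE : forall k : nat, x k.+1 = subgrad_step delta (g k))
    (N : nat) :
  (ln (cosh r) / ln (cosh delta) <= N%:R ->
     \big[Num.min/f (x 0%N) - fstar]_(0 <= k < N.+1) (f (x k) - fstar)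
       <= L * delta)
  /\ (delta <= 1 -> 4 / r * (r ^+ 2 / delta ^+ 2) <= N%:R ->
     \big[Num.min/f (x 0%N) - fstar]_(0 <= k < N.+1) (f (x k) - fstar)
       <= L * delta).
Proof.
have main : ln (cosh r) / ln (cosh delta) <= N%:R ->
    \big[Num.min/f (x 0%N) - fstar]_(0 <= k < N.+1) (f (x k) - fstar)
      <= L * delta.
  move=> NE; have [[z zp <-] _] := fstar_min.
  rewrite big_mkord.
  have xz : dist (x 0%N) z <= r by rewrite x0E.
  have [k kN kle] :=
    subgradient_method_gap f_lip L_gt0 r_gt0 delta_gt0 g_subdiff xSE xz NE.
  exact: le_trans (bigmin_le _ (Ordinal kN) _) kle.
split=> // d1 NE; apply: main; apply: le_trans NE.
by rewrite ln_cosh_ratio_le// delta_gt0.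
Qed.
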